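(* Let $n\ge2$ and let $\mathbb{Z}/2$ act on the Cuntz algebra $\mathcal{O}_n$ by the restriction of the gauge action. Then $\mathrm{dim}^{\mathbb{Z}/2}_{\mathrm{LT}}(\mathcal{O}_n)\le2n-1$.
   Context: $\mathcal{O}_n$ is the universal $C^*$-algebra generated by $S_1,\ldots,S_n$ with $S_i^*S_i=1$ for all $i$ and $\sum_{i=1}^nS_iS_i^*=1$. The gauge action of $\mathbb{S}^1$ is $S_i\mapsto zS_i$ for $z\in\mathbb{S}^1$; its restriction to $\mathbb{Z}/2=\{\pm1\}$ is generated by $S_i\mapsto-S_i$. Local-triviality dimension: let a compact group $G$ act on a unital $C^*$-algebra $A$. Equip $C(G)$ with $(\alpha_gf)(h)=f(hg)$ and $C_0((0,1])\otimes C(G)$ with the action on the second factor, and let $t$ be the identity function in $C_0((0,1])$. $\mathrm{dim}^G_{\mathrm{LT}}(A)$ is the smallest $m\ge0$ for which there exist $G$-equivariant $*$-homomorphisms $\rho_0,\ldots,\rho_m:C_0((0,1])\otimes C(G)\to A$ with $\sum_{i=0}^m\rho_i(t\otimes1)=1$ ($\infty$ if no such $m$ exists). *)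

(* Defs.v *)
From HB Require Import structures.
From mathcomp Require Import all_boot all_order all_algebra.
From mathcomp Require Import all_classical all_reals all_analysis.
From mathcomp Require Import complex.

Set Implicit Arguments.
Unset Strict Implicit.
Unset Printing Implicit Defensive.

Import Order.TTheory GRing.Theory Num.Theory numFieldNormedType.Exports.
Import ComplexField.Normc.

Local Open Scope classical_set_scope.
Local Open Scope ring_scope.

(* Unital C*-algebras.  An [algType] satisfies [1 != 0], so the zero algebra is
   left out; this does not affect the universal property below, since every
   algebra has exactly one map to the zero algebra.  The norm is a field of the
   record because the hierarchies of rings and of normed modules have no common
   substructure to which a normed algebra could belong. *)
Record cstarAlgType (R : realType) := CStarAlgType {
  cstar_alg :> algType R[i] ;
  cnorm : cstar_alg -> R ;
  star : cstar_alg -> cstar_alg ;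
  cnorm_ge0 : forall a, 0 <= cnorm a ;
  cnorm0_eq0 : forall a, cnorm a = 0 -> a = 0 ;
  cnormD_le : forall a b, cnorm (a + b) <= cnorm a + cnorm b ;
  cnormZ : forall (k : R[i]) a, cnorm (k *: a) = normc k * cnorm a ;
  cnormM_le : forall a b, cnorm (a * b) <= cnorm a * cnorm b ;
  cnorm_complete : forall u : nat -> cstar_alg,
    (forall e : R, 0 < e -> exists N : nat, forall p q : nat,
       (N <= p)%N -> (N <= q)%N -> cnorm (u p - u q) < e) ->
    exists l, cnorm (u k - l) @[k --> \oo] --> (0 : R) ;
  starK : involutive star ;
  starD : forall a b, star (a + b) = star a + star b ;
  starZ : forall (k : R[i]) a, star (k *: a) = k^* *: star a ;
  starM : forall a b, star (a * b) = star b * star a ;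
  cnorm_starM : forall a, cnorm (star a * a) = cnorm a ^+ 2
}.

Definition unital_star_hom (R : realType) (A B : cstarAlgType R)
    (phi : A -> B) : Prop :=
  [/\ linear phi, monoid_morphism phi & {morph phi : a / star a}].

HB.mixin Record isCompactGroup G of Group G & Topological G := {
  mulg_continuous : continuous (fun gh : G * G => (gh.1 * gh.2)%g) ;
  invg_continuous : continuous (fun g : G => (g^-1)%g) ;
  compactG : compact [set: G] ;
  hausdorffG : hausdorff_space G
}.

#[short(type="compactGroupType")]
HB.structure Definition CompactGroup :=
  {G of Group G & Topological G & isCompactGroup G}.

Record cstar_action (R : realType) (G : compactGroupType)
    (A : cstarAlgType R) := CStarAction {
  act :> G -> A -> A ;
  act_star_hom : forall g, unital_star_hom (act g) ;
  act1 : forall a, act 1%g a = a ;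
  actM : forall g h a, act (g * h)%g a = act g (act h a) ;
  act_continuous : forall a g,
    cnorm (act h a - act g a) @[h --> g] --> (0 : R)
}.

Definition C0 (R : realType) (X : topologicalType) : set (X -> R[i]) :=
  [set f : X -> R[i] | continuous (f : X -> (R[i] : numFieldType)) /\
           forall e : R, 0 < e -> compact [set x | e <= normc (f x)]].

Section LocalTriviality.
Variables (R : realType) (G : compactGroupType).

(* C_0((0,1]) \otimes C(G) is represented as C_0((0,1] * G), through
   (f \otimes u)(s, h) = f s * u h. *)
Definition cone_space : topologicalType := (set_type `]0%R, 1%R : R] * G)%type.

Definition cone_t1 : cone_space -> R[i] := fun x => ((set_val x.1)%:C)%C.

Definition cone_act (g : G) (f : cone_space -> R[i]) : cone_space -> R[i] :=
  fun x => f (x.1, (x.2 * g)%g).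

(* [rho] is a map on all functions on [cone_space]; only its values on [C0]
   are constrained, and only those are used. *)
Definition cone_star_hom (A : cstarAlgType R)
    (rho : (cone_space -> R[i]) -> A) : Prop :=
  [/\ forall (k : R[i]) f g, C0 f -> C0 g ->
        rho (fun x => k * f x + g x) = k *: rho f + rho g,
      forall f g, C0 f -> C0 g -> rho (fun x => f x * g x) = rho f * rho g &
      forall f, C0 f -> rho (fun x => (f x)^*) = star (rho f)].

Definition cone_equivariant (A : cstarAlgType R) (alpha : cstar_action G A)
    (rho : (cone_space -> R[i]) -> A) : Prop :=
  forall g f, C0 f -> rho (cone_act g f) = alpha g (rho f).

Definition LT_cover (A : cstarAlgType R) (alpha : cstar_action G A)
    (m : nat) : Prop :=
  exists rho : 'I_m.+1 -> (cone_space -> R[i]) -> A,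
    (forall i, cone_star_hom (rho i) /\ cone_equivariant alpha (rho i)) /\
    \sum_i rho i cone_t1 = 1.

(* An infimum of naturals is attained, and the infimum of the empty set is
   +oo. *)
Definition LT_dim (A : cstarAlgType R) (alpha : cstar_action G A) : \bar R :=
  ereal_inf [set (m%:R)%:E | m in [set m | LT_cover alpha m]].

End LocalTriviality.

(* Z/2 as {1, -1}, the sign (-1) ^+ b being encoded by the boolean b. *)
Definition Z2 : Type := bool.

HB.instance Definition _ := Choice.copy Z2 bool.
HB.instance Definition _ := Topological.copy Z2 bool.
HB.instance Definition _ := @isGroup.Build Z2
  false id addb addbA addFb addbF addbb addbb.

Fact Z2_mul_continuous : continuous (fun gh : Z2 * Z2 => (gh.1 * gh.2)%g).
Proof.
move=> [a b] U /principal_filterP Uab.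
exists ([set a], [set b]); first by split; exact/principal_filterP.
by move=> [c d] /= [-> ->].
Qed.

Fact Z2_inv_continuous : continuous (fun g : Z2 => (g^-1)%g).
Proof. by move=> a U. Qed.

HB.instance Definition _ := @isCompactGroup.Build Z2
  Z2_mul_continuous Z2_inv_continuous bool_compact (@discrete_hausdorff bool).

Definition cuntz_relations (R : realType) (n : nat) (A : cstarAlgType R)
    (S : 'I_n -> A) : Prop :=
  (forall i, star (S i) * S i = 1) /\ \sum_i S i * star (S i) = 1.

(* The universal property determines the algebra with its generators up to a
   unique isomorphism; the S_i generate it because of the uniqueness part. *)
Record cuntz_algebra (R : realType) (n : nat) := CuntzAlgebra {
  cuntz_alg :> cstarAlgType R ;
  cuntz_gen : 'I_n -> cuntz_alg ;
  cuntz_rel : cuntz_relations cuntz_gen ;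
  cuntz_univ : forall (B : cstarAlgType R) (T : 'I_n -> B),
    cuntz_relations T ->
    exists! phi : cuntz_alg -> B,
      unital_star_hom phi /\ forall i, phi (cuntz_gen i) = T i
}.

Section Gauge.
Variables (R : realType) (n : nat) (O : cuntz_algebra R n).
Local Notation S := (@cuntz_gen R n O).

Fact cuntz_relations_scale (z : R[i]) : `|z| = 1 ->
  cuntz_relations (fun i => z *: S i).
Proof.
move=> z1; have [S1 S2] := cuntz_rel O.
have zz : z * z^* = 1 by rewrite -normCK z1 expr1n.
split=> [i|]; first by rewrite starZ -scalerAl -scalerAr scalerA mulrC zz scale1r.
rewrite -[RHS]S2; apply: eq_bigr => i _.
by rewrite starZ -scalerAl -scalerAr scalerA zz scale1r.
Qed.

(* The automorphism S_i |-> z S_i. *)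
Definition gauge (z : R[i]) (z1 : `|z| = 1) : O -> O :=
  sval (cid (cuntz_univ O (cuntz_relations_scale z1))).

Fact gaugeP (z : R[i]) (z1 : `|z| = 1) :
  unital_star_hom (gauge z1) /\ forall i, gauge z1 (S i) = z *: S i.
Proof. by rewrite /gauge; case: cid => phi []. Qed.

Fact cuntz_hom_eq (phi psi : O -> O) :
  unital_star_hom phi -> unital_star_hom psi ->
  (forall i, phi (S i) = psi (S i)) -> phi =1 psi.
Proof.
move=> hphi hpsi e.
have rel : cuntz_relations (fun i => phi (S i)).
  have [S1 S2] := cuntz_rel O; have [phiL [phi1 phiM] phiS] := hphi.
  split=> [i|]; first by rewrite -phiS -phiM S1.
  pose phiA := GRing.isLinear.Build _ _ _ _ phi phiL.
  pose F : {linear O -> O} := HB.pack phi phiA.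
  rewrite -[RHS]phi1 -S2 -[phi]/(F : _ -> _) linear_sum.
  by apply: eq_bigr => i _; rewrite /= phiM phiS.
have [chi [_ uni]] := cuntz_univ O rel.
have e1 := uni phi (conj hphi (fun=> erefl)).
have e2 := uni psi (conj hpsi (fun i => esym (e i))).
by move=> a; rewrite -e1 -e2.
Qed.

Fact gauge1 (z1 : `|1 : R[i]| = 1) : gauge z1 =1 id.
Proof.
have [h e] := gaugeP z1.
by apply: cuntz_hom_eq => // i; rewrite e scale1r.
Qed.

Fact gaugeM (z w v : R[i]) (z1 : `|z| = 1) (w1 : `|w| = 1) (v1 : `|v| = 1) :
  v = z * w -> gauge v1 =1 gauge z1 \o gauge w1.
Proof.
move=> vE; have [h e] := gaugeP v1.
have [[hl [h1 hM] hS] ez] := gaugeP z1.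
have [[kl [k1 kM] kS] ew] := gaugeP w1.
have hZ c a : gauge z1 (c *: a) = c *: gauge z1 a.
  pose phiA := GRing.isLinear.Build _ _ _ _ (gauge z1) hl.
  pose F : {linear O -> O} := HB.pack (gauge z1) phiA.
  by rewrite -[gauge z1]/(F : _ -> _) linearZ.
apply: cuntz_hom_eq => //; last first.
  by move=> i /=; rewrite e ew hZ ez scalerA vE mulrC.
split=> [c a b|| a] /=; first by rewrite kl hl.
- by split=> [|a b] /=; rewrite ?k1 ?h1 // kM hM.
- by rewrite kS hS.
Qed.

Fact norm_sign (b : Z2) : `|(-1) ^+ (b : bool) : R[i]| = 1.
Proof. exact: normr_sign. Qed.

Definition gauge_Z2_act (b : Z2) : O -> O := gauge (norm_sign b).

Fact gauge_Z2_hom b : unital_star_hom (gauge_Z2_act b).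
Proof. by have [] := gaugeP (norm_sign b). Qed.

Fact gauge_Z2_1 a : gauge_Z2_act 1%g a = a.
Proof. exact: gauge1. Qed.

Fact gauge_Z2_M g h a :
  gauge_Z2_act (g * h)%g a = gauge_Z2_act g (gauge_Z2_act h a).
Proof. by apply: gaugeM; exact: signr_addb. Qed.

Fact gauge_Z2_continuous a g :
  cnorm (gauge_Z2_act h a - gauge_Z2_act g a) @[h --> g] --> (0 : R).
Proof.
have z0 : cnorm (gauge_Z2_act g a - gauge_Z2_act g a) = 0.
  by rewrite subrr -[X in cnorm X](scale0r 0) cnormZ normc0 mul0r.
move=> U U0; apply/principal_filterP; rewrite /= z0; exact: nbhs_singleton.
Qed.

(* The restriction to Z/2 of the gauge action of the circle. *)
Definition gauge_action_Z2 : cstar_action Z2 O :=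
  CStarAction gauge_Z2_hom gauge_Z2_1 gauge_Z2_M gauge_Z2_continuous.

End Gauge.

(* Main.v *)
(* Elements of finite spectrum make continuous functional calculus unnecessary.
   If M and t are isometries with t^* M = 0 and v = M t^* is odd, then
   x = v + v^* is odd and self-adjoint and q = x^2 = M M^* + t t^* is a
   projection, so that the spectral projections (q + x) / 2 and (q - x) / 2 are
   exchanged by the action.  For 0 < c <= 1, evaluation at the two points
   (c, 1) and (c, -1) is then an equivariant *-homomorphism, and it maps the
   coordinate function of the cone to c q.  It remains to write 1 as a
   combination of 2n such q.

   Relations among words need S_i^* S_j = 0 for i <> j, which follows from the
   positivity of the projections S_i S_i^*.  The only positivity needed is that
   a self-adjoint z with |1 + z| <= 1 and |1 - z| <= 1 vanishes: the C*-identity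
   gives |1 + k z| <= 1 + |k|^2 for small complex k, and Cauchy's estimate for
   (1 + k z)^N does the rest. *)
Require Import Defs.
From mathcomp Require Import all_boot all_order all_algebra.
From mathcomp Require Import all_classical all_reals all_analysis.
From mathcomp Require Import complex.

Set Implicit Arguments.
Unset Strict Implicit.
Unset Printing Implicit Defensive.

Import Order.TTheory GRing.Theory Num.Theory numFieldNormedType.Exports.
Import ComplexField.Normc.

Local Open Scope ring_scope.

(** * Norm estimates in a C*-algebra *)

Lemma normc_real (R : rcfType) (x : R) : normc (x%:C)%C = `|x|.
Proof. by rewrite /normc /= expr0n /= addr0 sqrtr_sqr. Qed.

Lemma normc_ge0 (R : rcfType) (k : R[i]) : 0 <= normc k.
Proof. by case: k => x y; exact: sqrtr_ge0. Qed.

Section CstarAlgebra.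
Variables (R : realType) (A : cstarAlgType R).
Implicit Types (a b z : A) (k : R[i]).

Lemma star0 : star (0 : A) = 0.
Proof. by apply: (addrI (star (0 : A))); rewrite -starD !addr0. Qed.

Lemma starN a : star (- a) = - star a.
Proof. by apply: (addrI (star a)); rewrite -starD !subrr star0. Qed.

Lemma star1 : star (1 : A) = 1.
Proof. by rewrite -[LHS]mulr1 -{2}[1]starK -starM mulr1 starK. Qed.

Lemma star_sum (I : Type) (r : seq I) (P : pred I) (F : I -> A) :
  star (\sum_(i <- r | P i) F i) = \sum_(i <- r | P i) star (F i).
Proof. by apply: big_morph; [exact: starD | exact: star0]. Qed.

Lemma cnorm0 : cnorm (0 : A) = 0.
Proof. by rewrite -(scale0r (0 : A)) cnormZ normc0 mul0r. Qed.

Lemma cnormN a : cnorm (- a) = cnorm a.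
Proof. by rewrite -scaleN1r cnormZ normcN normc1 mul1r. Qed.

Lemma cnorm1 : cnorm (1 : A) = 1.
Proof.
have := cnorm_starM (1 : A); rewrite star1 mulr1 => /eqP.
rewrite -subr_eq0 expr2 -[X in X - _]mulr1 -mulrBr mulf_eq0 subr_eq0.
case/orP => [/eqP/cnorm0_eq0/eqP|/eqP <- //]; by rewrite oner_eq0.
Qed.

Lemma cnorm_star a : cnorm (star a) = cnorm a.
Proof.
suff le b : cnorm b <= cnorm (star b).
  by apply/eqP; rewrite eq_le le -{2}[a]starK le.
have [b0|b0] := eqVneq (cnorm b) 0; first by rewrite b0 cnorm_ge0.
have bp : 0 < cnorm b by rewrite lt_def b0 cnorm_ge0.
by rewrite -(ler_pM2r bp) -expr2 -cnorm_starM cnormM_le.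
Qed.

Lemma cnorm_sum (I : Type) (r : seq I) (P : pred I) (F : I -> A) :
  cnorm (\sum_(i <- r | P i) F i) <= \sum_(i <- r | P i) cnorm (F i).
Proof.
elim/big_ind2 : _ => [|x1 a x2 b h1 h2|//]; first by rewrite cnorm0.
by apply: le_trans (cnormD_le _ _) _; exact: lerD.
Qed.

Lemma cnorm_projection_le1 a : star a = a -> a * a = a -> cnorm a <= 1.
Proof.
move=> sa aa; have := cnorm_starM a; rewrite sa aa expr2 => h.
have [->|a0] := eqVneq (cnorm a) 0; first exact: ler01.
suff -> : cnorm a = 1 by [].
by apply: (mulfI a0); rewrite -h mulr1.
Qed.

Lemma cnorm_isometry_le1 a : star a * a = 1 -> cnorm a <= 1.
Proof.
move=> h; have := cnorm_starM a; rewrite h cnorm1 => e.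
by rewrite -(@ler_pXn2r _ 2) ?nnegrE ?cnorm_ge0 // expr1n -e.
Qed.

Lemma cnormX_le a m : cnorm (a ^+ m) <= cnorm a ^+ m.
Proof.
elim: m => [|m ih]; first by rewrite !expr0 cnorm1.
rewrite !exprS; apply: le_trans (cnormM_le _ _) _.
by apply: ler_wpM2l => //; exact: cnorm_ge0.
Qed.

(* Averaging over [zeta] and [- zeta] turns the values on a circle of a
   polynomial of degree < 2 ^ k.+1 into those of one of degree < 2 ^ k in
   [zeta ^+ 2], with the same constant term. *)
Lemma cnorm_coef0_le (k : nat) (c : nat -> A) (rho B : R) : 0 <= rho ->
  (forall zeta, normc zeta = rho ->
     cnorm (\sum_(j < 2 ^ k) zeta ^+ j *: c j) <= B) ->
  cnorm (c 0%N) <= B.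
Proof.
elim: k c rho => [|k ih] c rho rho0 h.
  have := h (rho%:C)%C; rewrite expn0 big_ord1 expr0 scale1r; apply.
  by rewrite normc_real ger0_norm.
apply: (ih (fun j => c (2 * j)%N) (rho ^+ 2)) => [|xi xirho].
  exact: exprn_ge0.
pose zeta := sqrtC xi.
have zetarho : normc zeta = rho.
  apply/eqP; rewrite -(@eqrXn2 _ 2) //; last exact: normc_ge0.
  by rewrite expr2 -normcM -expr2 sqrtCK xirho.
have sum2 m (F : nat -> A) :
    \sum_(j < 2 * m) F j = \sum_(j < m) (F (2 * j)%N + F (2 * j).+1).
  elim: m => [|m ihm]; first by rewrite muln0 !big_ord0.
  by rewrite mulnS !big_ord_recr /= ihm addrA.
have := h (- zeta); rewrite normcN => /(_ zetarho); have := h zeta zetarho.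
rewrite expnS (sum2 _ (fun j => zeta ^+ j *: c j)).
rewrite (sum2 _ (fun j => (- zeta) ^+ j *: c j)) => h1 h2.
have -> : \sum_(j < 2 ^ k) xi ^+ j *: c (2 * j)%N = (2^-1%:C)%C *:
  (\sum_(j < 2 ^ k) (zeta ^+ (2 * j) *: c (2 * j)%N +
                     zeta ^+ (2 * j).+1 *: c (2 * j).+1) +
   \sum_(j < 2 ^ k) ((- zeta) ^+ (2 * j) *: c (2 * j)%N +
                     (- zeta) ^+ (2 * j).+1 *: c (2 * j).+1)).
  rewrite -big_split scaler_sumr; apply: eq_bigr => j _ /=.
  rewrite !exprS !exprM sqrrN sqrtCK mulNr scaleNr addrACA subrr addr0.
  rewrite -scalerDl scalerA -mulr2n -[X in _ * X]mulr_natl mulrA.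
  by rewrite mulr_natr -rmorphMn -mulr_natr mulVf ?mul1r ?pnatr_eq0.
rewrite cnormZ normc_real ger0_norm ?invr_ge0 ?ler0n //.
rewrite mulrC ler_pdivrMr ?ltr0n // mulr_natr mulr2n.
by apply: le_trans (cnormD_le _ _) _; exact: lerD.
Qed.

(** For s >= 0, [1 + s z] is a convex combination of [1] and [1 + z]; a negative s is absorbed into
    [- z]. *)
Lemma cnorm_1D_scale_le1 z (s : R) :
  cnorm (1 + z) <= 1 -> cnorm (1 - z) <= 1 -> `|s| <= 1 ->
  cnorm (1 + (s%:C)%C *: z) <= 1.
Proof.
wlog s0 : z s / 0 <= s => [wlg zD zB s1|zD zB].
  have [s0|s0] := leP 0 s; first exact: wlg.
  rewrite -[z]opprK scalerN -scaleNr -rmorphN /=; apply: wlg => //.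
  - by rewrite oppr_ge0 ltW.
  - by rewrite opprK.
  - by rewrite normrN.
rewrite ger0_norm // => s1.
have -> : 1 + (s%:C)%C *: z = ((1 - s)%:C)%C *: (1 : A) + (s%:C)%C *: (1 + z).
  by rewrite rmorphB rmorph1 scalerBl scale1r scalerDr addrA subrK.
apply: le_trans (cnormD_le _ _) _.
rewrite !cnormZ cnorm1 mulr1 !normc_real !ger0_norm // ?subr_ge0 //.
by rewrite -lerBrDl subKr ler_piMr.
Qed.

(* The cross term [2 Re k] is at most 1 in modulus, so that only the second
   order term can push the norm above 1. *)
Lemma cnorm_1D_scale_le z k : star z = z ->
  cnorm (1 + z) <= 1 -> cnorm (1 - z) <= 1 -> normc k <= 2^-1 ->
  cnorm (1 + k *: z) <= 1 + normc k ^+ 2.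
Proof.
move=> sz zD zB k2.
have z1 : cnorm z <= 1.
  have : cnorm ((1 + z) - (1 - z)) <= 1 + 1.
    by apply: le_trans (cnormD_le _ _) _; rewrite cnormN; exact: lerD.
  rewrite opprB addrC addrA subrK -mulr2n -scaler_nat cnormZ.
  by rewrite normcMn normc1 ger_pMr // ltr0n.
(* A number that is at least 1 is at most its square, so bounding the square, which the C*-identity
   computes, is enough. *)
suff : cnorm (1 + k *: z) ^+ 2 <= 1 + normc k ^+ 2.
  move=> h; rewrite -(@ler_pXn2r _ 2) ?nnegrE ?cnorm_ge0 //; last first.
    by rewrite addr_ge0 ?sqr_ge0.
  by apply: le_trans h _; rewrite ler_eXnr // lerDl sqr_ge0.
rewrite -cnorm_starM starD star1 starZ sz.
have -> : (1 + k^* *: z) * (1 + k *: z) =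
    (1 + ((2 * complex.Re k)%:C)%C *: z) + (k * k^*) *: (z * z).
  rewrite mulrDl mul1r mulrDr mulr1 -scalerAl -scalerAr scalerA addrA.
  rewrite (mulrC k); congr (_ + _).
  rewrite -addrA -scalerDl; congr (1 + _ *: _).
  case: k {k2} => x y; apply/eqP.
  by rewrite eq_complex /= subrr mulr_natl mulr2n !eqxx.
apply: le_trans (cnormD_le _ _) _; apply: lerD.
  apply: cnorm_1D_scale_le1 => //.
  rewrite normrM ger0_norm // mulrC -ler_pdivlMr // div1r; apply: le_trans k2.
  by rewrite -lecR; exact: (normc_ge_Re k).
rewrite cnormZ normcM.
have -> : normc k^* = normc k by case: k {k2} => x y /=; rewrite sqrrN.
rewrite -expr2 ler_piMr ?sqr_ge0 //.
by apply: le_trans (cnormM_le _ _) _; rewrite mulr_ile1 ?cnorm_ge0.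
Qed.

(* Cauchy's estimate for the linear coefficient of [(1 + zeta *: z) ^+ N] on
   the circle of radius 2 ^- k, with N = 4 ^ k. *)
Lemma selfadjoint_eq0 z : star z = z ->
  cnorm (1 + z) <= 1 -> cnorm (1 - z) <= 1 -> z = 0.
Proof.
move=> sz zD zB; apply: cnorm0_eq0; apply/eqP; apply: contraT => r0.
have rp : 0 < cnorm z by rewrite lt_def r0 cnorm_ge0.
(* On the circle e bounds [(1 + zeta *: z) ^+ N]; the extra 1 pays for subtracting the constant
   term. *)
pose B : R := expR 1 + 1.
suff bound (k : nat) : (0 < k)%N -> (2 ^ k)%:R * cnorm z <= B.
  have [k kB] : exists k : nat, B / cnorm z < k%:R.
    exists (Num.truncn (B / cnorm z)).+1; exact: truncnS_gt.
  have k0 : (0 < k)%N.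
    rewrite -(ltr_nat R); apply: le_lt_trans kB.
    by rewrite divr_ge0 ?cnorm_ge0 // addr_ge0 // ?expR_ge0.
  have := bound k k0; rewrite -ler_pdivlMr // => h.
  have := lt_le_trans (le_lt_trans h kB) (ltW _ : k%:R <= (2 ^ k)%:R :> R).
  by rewrite ltxx ltr_nat ltn_expl // => /(_ isT).
move=> k0; pose rho : R := 2 ^- k; pose N := (2 ^ (2 * k))%N.
have rp' : 0 < rho by rewrite invr_gt0 exprn_gt0.
have rhoN : rho ^+ 2 = N%:R^-1.
  by rewrite /rho /N natrX exprVn -exprM mulnC.
suff : cnorm (z *+ N) <= B / rho.
  rewrite -scaler_nat cnormZ normcMn normc1 ler_pdivlMr // => h.
  apply: le_trans h; rewrite mulrAC ler_wpM2r ?cnorm_ge0 //.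
  by rewrite /N /rho mul2n -addnn expnD natrM natrX mulfK ?expf_neq0 ?pnatr_eq0.
(* Dividing [(1 + zeta *: z) ^+ N - 1] by [zeta] turns the linear coefficient into a constant term
   and leaves N terms, a power of two. *)
have := @cnorm_coef0_le (2 * k) (fun j => z ^+ j.+1 *+ 'C(N, j.+1)) rho
  (B / rho).
rewrite expr1 bin1; apply; first exact: ltW.
move=> zeta zr; rewrite ler_pdivlMr // mulrC -zr -cnormZ.
have -> : zeta *: (\sum_(j < N) zeta ^+ j *: (z ^+ j.+1 *+ 'C(N, j.+1))) =
    (1 + zeta *: z) ^+ N - 1.
  rewrite [1 + _]addrC exprD1n big_ord_recl /= expr0 bin0 mulr1n addrC addKr.
  rewrite scaler_sumr; apply: eq_bigr => j _.
  by rewrite scalerA -exprS /bump /= add1n exprZn scalerMnr.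
apply: le_trans (cnormD_le _ _) _; rewrite cnormN cnorm1 lerD2r.
apply: le_trans (cnormX_le _ _) _.
have zeta2 : normc zeta <= 2^-1.
  rewrite zr /rho -[leRHS]expr1 -exprVn; apply: ler_wiXn2l => //.
  by rewrite invf_le1 ?ler1n.
apply: le_trans (_ : (1 + normc zeta ^+ 2) ^+ N <= _).
  rewrite lerXn2r ?nnegrE ?cnorm_ge0 ?addr_ge0 ?sqr_ge0 //.
  exact: cnorm_1D_scale_le.
(* The radius was chosen with [rho ^+ 2] = 1 / N, so that this power stays below e. *)
rewrite zr rhoN; apply: le_trans (_ : expR N%:R^-1 ^+ N <= _).
  rewrite lerXn2r ?nnegrE ?expR_ge0 ?addr_ge0 ?invr_ge0 ?ler0n //.
  exact: expR_ge1Dx.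
by rewrite -expRM_natl mulfV // pnatr_eq0 expn_eq0.
Qed.

End CstarAlgebra.

(** * Orthogonality of the Cuntz isometries *)

Section Orthogonality.
Variables (R : realType) (A : cstarAlgType R).

(** The closed unit ball around 1 is convex. *)
Lemma cnorm_1B_mean_le1 n (G : 'I_n.+1 -> A) :
  (forall l, cnorm (1 - G l) <= 1) ->
  cnorm (1 - n.+1%:R^-1 *: \sum_l G l) <= 1.
Proof.
move=> hG; have n0 : (n.+1%:R : R[i]) != 0 by rewrite pnatr_eq0.
have -> : 1 - n.+1%:R^-1 *: \sum_l G l = n.+1%:R^-1 *: \sum_l (1 - G l).
  rewrite sumrB scalerBr sumr_const card_ord -(scaler_nat _ (1 : A)) scalerA.
  by rewrite mulVf ?scale1r.
rewrite cnormZ normcV normcMn normc1 mulrC ler_pdivrMr ?ltr0n // mul1r.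
apply: le_trans (cnorm_sum _ _ _) _.
apply: le_trans (_ : \sum_(l < n.+1) (1 : R) <= _); first exact: ler_sum.
by rewrite sumr_const card_ord.
Qed.

(* [star (S j) * S i * star (S i) * S j] and the sum of its analogues over the
   indices other than [i] and [j], which is its opposite, are both sums of
   elements [y] with [cnorm (1 - y) <= 1]. *)
Lemma cuntz_relations_orthogonal n (S : 'I_n -> A) i j :
  cuntz_relations S -> i != j -> star (S i) * S j = 0.
Proof.
case: n S i j => [|n] S i j; first by case: i.
case=> iso sum1 ij.
pose y l := star (S j) * (S l * star (S l)) * S j.
have sy l : star (y l) = y l by rewrite /y !starM !starK !mulrA.
have y1 l : cnorm (1 - y l) <= 1.
  have -> : 1 - y l = star (S j) * (1 - S l * star (S l)) * S j.
    by rewrite mulrBr mulrBl mulr1 iso.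
  have pp : (S l * star (S l)) * (S l * star (S l)) = S l * star (S l).
    by rewrite mulrA -(mulrA (S l)) iso mulr1.
  have e1 : cnorm (1 - S l * star (S l)) <= 1.
    apply: cnorm_projection_le1.
      by rewrite starD star1 starN starM starK.
    by rewrite mulrBr mulrBl mulr1 mul1r mulrBl pp mul1r subrr subr0.
  apply: le_trans (cnormM_le _ _) _; rewrite mulr_ile1 ?cnorm_ge0 //;
    last exact: cnorm_isometry_le1.
  apply: le_trans (cnormM_le _ _) _; rewrite mulr_ile1 ?cnorm_ge0 //.
  by rewrite cnorm_star cnorm_isometry_le1.
have yj : y j = 1 by rewrite /y mulrA iso mul1r iso.
have sumy : \sum_(l | (l != j) && (l != i)) y l = - y i.
  have : \sum_l y l = 1.
    by rewrite /y -mulr_suml -mulr_sumr sum1 mulr1 iso.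
  rewrite (bigD1 j) //= yj -[RHS]addr0 => /addrI.
  by rewrite (bigD1 i) //= addrC => /eqP; rewrite addr_eq0 => /eqP.
suff : n.+1%:R^-1 *: y i = 0.
  (* [y i] is [b^* b] for [b = S_i^* S_j], so its vanishing gives that of [b]. *)
  move/eqP; rewrite scaler_eq0 invr_eq0 pnatr_eq0 /= => /eqP yi0.
  apply: cnorm0_eq0; apply/eqP; rewrite -sqrf_eq0 -cnorm_starM.
  by rewrite starM starK mulrA -(mulrA (star (S j))) -/(y i) yi0 cnorm0.
apply: selfadjoint_eq0.
- by rewrite starZ sy fmorphV rmorph_nat.
(* Indices outside the sum are filled with 0, which is also within distance 1 of 1; this makes the
   restricted sum a mean over all indices. *)
- rewrite -[n.+1%:R^-1 *: _]opprK -scalerN -sumy big_mkcond.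
  apply: cnorm_1B_mean_le1 => l; case: ifP => // _.
  by rewrite subr0 cnorm1.
- have -> : y i = \sum_(l | l == i) y l by rewrite big_pred1_eq.
  rewrite big_mkcond; apply: cnorm_1B_mean_le1 => l; case: ifP => // _.
  by rewrite subr0 cnorm1.
Qed.

End Orthogonality.

(** * Equivariant covers from sign projections *)

(** When [x] is self-adjoint and its square is the projection [q], this is the spectral projection
    of [x] at the eigenvalue [(-1) ^+ h]. *)
Definition sign_projection (R : realType) (A : cstarAlgType R) (q x : A)
    (h : bool) : A :=
  2^-1 *: (q + (-1) ^+ h *: x).

Lemma sign_projectionM (R : realType) (A : cstarAlgType R) (q x : A) h k :
  q * q = q -> q * x = x -> x * q = x -> x * x = q ->
  sign_projection q x h * sign_projection q x k =
  if h == k then sign_projection q x h else 0.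
Proof.
move=> qq qx xq xx; rewrite /sign_projection -scalerAl -scalerAr scalerA.
rewrite mulrDl !mulrDr -!scalerAl -!scalerAr qq qx xq xx scalerA -signr_addb.
have half (a : A) : (2^-1 * 2^-1) *: (a + a) = 2^-1 *: a.
  by rewrite -mulr2n -(scaler_nat 2 a) scalerA -mulrA mulVf ?mulr1 ?pnatr_eq0.
case: h; case: k; rewrite /= ?expr0 ?expr1 ?scale1r ?scaleN1r.
- by rewrite [- x + q]addrC half.
- by rewrite -opprD [x + q]addrC subrr scaler0.
- by rewrite -[x - q]opprB subrr scaler0.
- by rewrite [x + q]addrC half.
Qed.

Section Action.
Variables (R : realType) (G : compactGroupType) (A : cstarAlgType R).
Variable alpha : cstar_action G A.

Lemma act_linear g : linear (alpha g).
Proof. by case: (act_star_hom alpha g) => h _ _; exact: h. Qed.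

Lemma actD g a b : alpha g (a + b) = alpha g a + alpha g b.
Proof. by rewrite -[a in LHS]scale1r act_linear scale1r. Qed.

Lemma act0 g : alpha g 0 = 0.
Proof. by apply: (addrI (alpha g 0)); rewrite -actD !addr0. Qed.

Lemma actZ g k a : alpha g (k *: a) = k *: alpha g a.
Proof. by rewrite -[k *: a]addr0 act_linear act0 addr0. Qed.

Lemma act_mul g a b : alpha g (a * b) = alpha g a * alpha g b.
Proof. by have [_ [_ ->]] := act_star_hom alpha g. Qed.

Lemma act_star g a : alpha g (star a) = star (alpha g a).
Proof. by have [_ _ ->] := act_star_hom alpha g. Qed.

Lemma act_sum g (I : Type) (r : seq I) (P : pred I) (F : I -> A) :
  alpha g (\sum_(i <- r | P i) F i) = \sum_(i <- r | P i) alpha g (F i).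
Proof. by apply: big_morph; [exact: actD | exact: act0]. Qed.

End Action.

Lemma LT_cover_isometries (R : realType) (A : cstarAlgType R)
    (alpha : cstar_action Z2 A) (I : finType) (m : nat) (c : I -> R)
    (M t : I -> A) :
  #|I| = m.+1 -> (forall i, 0 < c i <= 1) ->
  (forall i, star (M i) * M i = 1) -> (forall i, star (t i) * t i = 1) ->
  (forall i, star (t i) * M i = 0) ->
  (forall i (g : Z2), alpha g (M i * star (t i)) =
     (-1) ^+ (g : bool) *: (M i * star (t i))) ->
  \sum_i ((c i)%:C)%C *: (M i * star (M i) + t i * star (t i)) = 1 ->
  LT_cover alpha m.
Proof.
move=> cardI c01 MM tt tM odd sum1.
have Mt i : star (M i) * t i = 0 by rewrite -[LHS]starK starM starK tM star0.
(* [M M^*], [M t^*], [t M^*] and [t t^*] multiply as 2 by 2 matrix units, with [q] as the identity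
   matrix and [x] as the flip. *)
pose q i := M i * star (M i) + t i * star (t i).
pose x i := M i * star (t i) + t i * star (M i).
have word (a b d e : A) : a * star b * (d * star e) = a * (star b * d) * star e.
  by rewrite !mulrA.
have qq i : q i * q i = q i.
  by rewrite /q mulrDl !mulrDr !word MM tt tM Mt !mulr0 !mul0r !mulr1
    addr0 add0r.
have qx i : q i * x i = x i.
  by rewrite /q /x mulrDl !mulrDr !word MM tt tM Mt !mulr0 !mul0r !mulr1
    addr0 add0r.
have xq i : x i * q i = x i.
  by rewrite /q /x mulrDl !mulrDr !word MM tt tM Mt !mulr0 !mul0r !mulr1
    addr0 add0r addrC.
have xx i : x i * x i = q i.
  by rewrite /q /x mulrDl !mulrDr !word MM tt tM Mt !mulr0 !mul0r !mulr1
    addr0 add0r.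
have sq i : star (q i) = q i by rewrite /q starD !starM !starK.
have sx i : star (x i) = x i by rewrite /x starD !starM !starK addrC.
have ax i (g : Z2) : alpha g (x i) = (-1) ^+ (g : bool) *: x i.
  rewrite /x scalerDr actD odd -[t i * _]starK starM starK act_star odd.
  by rewrite starZ rmorph_sign.
have aq i g : alpha g (q i) = q i.
  by rewrite -xx act_mul ax -scalerAl -scalerAr scalerA -expr2 sqrr_sign
    scale1r.
pose p i := sign_projection (q i) (x i).
have sp i h : star (p i h) = p i h.
  by rewrite /p /sign_projection starZ starD starZ sq sx rmorph_sign fmorphV
    rmorph_nat.
have ap i (g : Z2) h : alpha g (p i h) = p i (h (+) g).
  by rewrite /p /sign_projection actZ actD actZ aq ax scalerA signr_addb.
have pp i h k : p i h * p i k = if h == k then p i h else 0.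
  exact: sign_projectionM.
have pD i : p i false + p i true = q i.
  rewrite /p /sign_projection -scalerDr expr0 expr1 scale1r scaleN1r addrACA.
  by rewrite subrr addr0 -mulr2n -(scaler_nat 2 (q i)) scalerA mulVf
    ?scale1r.
clearbody p.
have c_in i : c i \in `]0, 1]%classic.
  by rewrite inE /= in_itv /=; exact: c01.
pose s i : set_type `]0%R, 1%R : R] := SigSub (c_in i).
pose F i (f : cone_space R Z2 -> R[i]) : A :=
  f (s i, false) *: p i false + f (s i, true) *: p i true.
pose e (k : 'I_m.+1) : I := enum_val (cast_ord (esym cardI) k).
have e_bij : bijective e.
  exists (fun i => cast_ord cardI (enum_rank i)) => [k|i].
    by rewrite /e enum_valK cast_ordKV.
  by rewrite /e cast_ordK enum_rankK.
exists (fun k => F (e k)); split; last first.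
  rewrite -[RHS]sum1 (reindex e) /=; last exact: onW_bij.
  apply: eq_bigr => k _; rewrite /F /cone_t1 /= -scalerDr; congr (_ *: _).
  by rewrite pD.
move=> k; split; first split.
- move=> a f g _ _; rewrite /F !scalerDl !scalerDr !scalerA.
  by rewrite addrACA.
- move=> f g _ _; rewrite /F mulrDl !mulrDr -!scalerAl -!scalerAr
    !pp /=.
  by rewrite !scaler0 addr0 add0r !scalerA.
- by move=> f _; rewrite /F starD !starZ !sp.
move=> g f _; rewrite /F actD !actZ !ap /cone_act /=.
by case: g; rewrite //= addrC.
Qed.

(** * The cover of the Cuntz algebra *)

(** Serves for both [M^* M] and [M M^*], where [M] is the sum of the [u_j S_j^*], by exchanging the
    two families. *)
Lemma mulr_sum_orthonormal (R : realType) (A : cstarAlgType R) (n : nat)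
    (U V : 'I_n -> A) :
  (forall j l, star (V j) * V l = (j == l)%:R) ->
  (\sum_j U j * star (V j)) * (\sum_l V l * star (U l)) =
  \sum_j U j * star (U j).
Proof.
move=> VV; rewrite mulr_suml; apply: eq_bigr => j _.
rewrite mulr_sumr (bigD1 j) //= big1 ?addr0 => [|l lj].
  by rewrite mulrA -(mulrA (U j)) VV eqxx mulr1.
by rewrite mulrA -(mulrA (U j)) VV eq_sym (negPf lj) mulr0 mul0r.
Qed.

(* With generators S_0, ..., S_(n-1), the projections S_i S_i^* and
   S_0 S_i S_i^* S_0^* are paired off for i >= 2.
   The remaining words [W k] of length two are n + 2 in number, and any n + 1 of
   them split into a first one and n others; the latter add up to the range of
   an odd isometry [M], and the weights 1 / (n + 1) make up for each word being
   left out once. *)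
Lemma gauge_LT_cover (R : realType) (m : nat) (O : cuntz_algebra R (2 + m)) :
  LT_cover (gauge_action_Z2 O) (2 * m.+2 - 1).
Proof.
pose S : 'I_(2 + m) -> O := @cuntz_gen R (2 + m) O.
have rel : cuntz_relations S := cuntz_rel O.
have [iso sum1] := rel.
have SS i j : star (S i) * S j = (i == j)%:R.
  have [->|ij] := eqVneq i j; first exact: iso.
  exact: cuntz_relations_orthogonal rel ij.
pose S0 := S (lshift m ord0); pose S1 := S (lshift m ord_max).
have SS0 : star S0 * S0 = 1 by exact: iso.
have SS1 : star S1 * S1 = 1 by exact: iso.
have S01 : star S0 * S1 = 0 by rewrite SS.
have S10 : star S1 * S0 = 0 by rewrite SS.
(* The words [S_0 S_0], [S_0 S_1], and [S_1 S_j] for every j. *)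
pose W (k : 'I_(2 + (2 + m))) : O :=
  match fintype.split k with
  | inl i => S0 * S (lshift m i)
  | inr j => S1 * S j
  end.
have Wl i : W (lshift _ i) = S0 * S (lshift m i).
  by rewrite /W (unsplitK (inl i)).
have Wr j : W (rshift _ j) = S1 * S j by rewrite /W (unsplitK (inr j)).
have word (a b d e : O) : star (a * b) * (d * e) = star b * (star a * d) * e.
  by rewrite starM !mulrA.
have WW k l : star (W k) * W l = (k == l)%:R.
  case: (split_ordP k) => i ->; case: (split_ordP l) => j ->;
    rewrite ?Wl ?Wr word ?SS0 ?SS1 ?S01 ?S10 ?mulr0 ?mul0r ?mulr1 ?SS.
  - by rewrite !eq_lshift.
  - by rewrite eq_lrshift.
  - by rewrite eq_rlshift.
  - by rewrite eq_rshift.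
(* The outer [lift] leaves out word k, the inner one the first of the remaining words, which becomes
   [t (inr k)]. *)
pose u (k : 'I_(2 + (2 + m))) (j : 'I_(2 + m)) := W (lift k (lift ord0 j)).
have uu k j l : star (u k j) * u k l = (j == l)%:R.
  by rewrite WW !(inj_eq (@lift_inj _ _)).
pose M (i : 'I_m + 'I_(2 + (2 + m))) : O :=
  match i with
  | inl i => S0 * S (rshift 2 i)
  | inr k => \sum_j u k j * star (S j)
  end.
pose t (i : 'I_m + 'I_(2 + (2 + m))) : O :=
  match i with inl i => S (rshift 2 i) | inr k => W (lift k ord0) end.
pose c (i : 'I_m + 'I_(2 + (2 + m))) : R :=
  match i with inl _ => 1 | inr _ => m.+3%:R^-1 end.
have starMk k : star (M (inr k)) = \sum_j S j * star (u k j).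
  by rewrite /M star_sum; apply: eq_bigr => j _; rewrite starM starK.
apply: (@LT_cover_isometries _ _ _ _ _ c M t).
(* With n = m + 2 there are (n - 2) + (n + 2) = 2n indices. *)
- by rewrite card_sum !card_ord mul2n !doubleS subn1 -addnn !addSn !addnS.
- case=> k /=; first by rewrite ltr01 lexx.
  by rewrite invr_gt0 ltr0n /= invf_le1 ?ltr0n // ler1n.
- case=> k; first by rewrite word SS0 mulr1 SS eqxx.
  by rewrite starMk mulr_sum_orthonormal.
- by case=> k; rewrite /t ?SS ?WW eqxx.
- case=> k; rewrite /M /t.
    by rewrite mulrA SS eq_rlshift mul0r.
  rewrite mulr_sumr big1 // => j _.
  by rewrite mulrA WW (inj_eq (@lift_inj _ _)) (negPf (neq_lift _ _)) mul0r.
- move=> i g; set e : R[i] := _ ^+ _.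
  have ee : e * e = 1 by rewrite -expr2 sqrr_sign.
  have aS j : gauge_action_Z2 O g (S j) = e *: S j.
    by have [_ gS] := gaugeP O (norm_sign R g); exact: gS.
  have aSS j l : gauge_action_Z2 O g (S j * S l) = S j * S l.
    by rewrite act_mul !aS -scalerAl -scalerAr scalerA ee scale1r.
  have aW k : gauge_action_Z2 O g (W k) = W k.
    by case: (split_ordP k) => j ->; rewrite ?Wl ?Wr aSS.
  have se : e^* = e by rewrite /e rmorph_sign.
  rewrite act_mul act_star; case: i => k; rewrite /M /t.
    by rewrite aSS aS starZ se scalerAr.
  rewrite aW act_sum scalerAl scaler_sumr; congr (_ * _); apply: eq_bigr => j _.
  by rewrite act_mul act_star aW aS starZ se scalerAr.
rewrite big_sumType /=.
have -> : \sum_(k < 2 + (2 + m)) (m.+3%:R^-1%:C)%C *: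
    (M (inr k) * star (M (inr k)) + t (inr k) * star (t (inr k))) =
    \sum_k W k * star (W k).
  rewrite -scaler_sumr.
  (* The k-th term is the sum of all word projections except that of [W k]. *)
  have -> : \sum_(k < 2 + (2 + m))
      (M (inr k) * star (M (inr k)) + t (inr k) * star (t (inr k))) =
      \sum_(k < 2 + (2 + m))
        (\sum_l W l * star (W l) - W k * star (W k)).
    apply: eq_bigr => k _.
    rewrite starMk /= mulr_sum_orthonormal //.
    rewrite (bigD1_ord k) //= addrC addrK.
    by rewrite [RHS]big_ord_recl addrC.
  rewrite sumrB sumr_const card_ord -[(2 + (2 + m))%N]/(m.+4) mulrSr addrK.
  by rewrite -(scaler_nat m.+3 (\sum_k _)) scalerA fmorphV rmorph_nat mulVf
    ?scale1r.
(* The word projections beginning with [S_0] and the paired [S_0 S_i S_i^* S_0^*] add up to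
   [S_0 S_0^*], those beginning with [S_1] to [S_1 S_1^*]; the paired [S_i S_i^*] complete the sum
   to 1. *)
rewrite big_split_ord /=.
have left2 j k :
    (S j * S k) * star (S j * S k) = S j * (S k * star (S k)) * star (S j).
  by rewrite starM !mulrA.
under eq_bigr do rewrite scale1r left2.
under [X in _ + (X + _)]eq_bigr do rewrite Wl left2.
under [X in _ + (_ + X)]eq_bigr do rewrite Wr left2.
rewrite big_split /= -!mulr_suml -!mulr_sumr sum1 mulr1 addrACA.
rewrite -mulrDl -mulrDr; move: sum1; rewrite big_split_ord /= addrC => sum1.
rewrite sum1 mulr1 -[RHS]sum1 big_ord_recl big_ord1 addrCA.
by rewrite (_ : lift ord0 ord0 = ord_max) //; exact: val_inj.
Qed.

Theorem proposition5p2 (R : realType) (n : nat) (hn : (2 <= n)%N)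
    (O : cuntz_algebra R n) :
  (LT_dim (gauge_action_Z2 O) <= ((2 * n - 1)%N%:R)%:E)%E.
Proof.
case: n hn O => [|[|m]] // _ O.
apply: ereal_inf_lbound; exists (2 * m.+2 - 1)%N => //.
exact: gauge_LT_cover.
Qed.
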